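(* Let $\Delta_k=\hat A_k^{\mathrm{LS}}-A_k^{\mathrm{SeqAU}}$ be the advantage bias, where $\hat A_k^{\mathrm{LS}}$ is computed from $\hat\varphi$ fit on rollouts collected under $\mu$. For any $k\in\{1,\dots,K\}$ and any $a_{\le k}=(a_{<k},a_k)$, $$|\Delta_k(a_{\le k})|\;\le\;\mathbb E_{\pi_{\ge k}\mid a_{<k}}\bigl[\delta_k^{\varepsilon}(a_{-k})\bigr]\;+\;\|\varepsilon\|_\infty\cdot\max_{a_k,a_k'\in\mathcal A_k}\bigl\|\pi_{>k}(\cdot\mid a_{<k},a_k)-\pi_{>k}(\cdot\mid a_{<k},a_k')\bigr\|_1,$$ where $\delta_k^{\varepsilon}(a_{-k})=\max_{a_k,a_k'\in\mathcal A_k}\bigl|\varepsilon(a_{<k},a_k,a_{>k})-\varepsilon(a_{<k},a_k',a_{>k})\bigr|$.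
   Context: Setting. A cooperative team of $K$ agents acts in the fixed order $1,\dots,K$. Agent $k$ has a finite action set $\mathcal A_k$ of size $A$, observes the prefix $a_{<k}=(a_1,\dots,a_{k-1})$, and samples $a_k\sim\pi_k(\cdot\mid a_{<k})$. Write $a=(a_1,\dots,a_K)$, $a_{\le k}=(a_{<k},a_k)$, $a_{>k}=(a_{k+1},\dots,a_K)$, $a_{-k}=(a_{<k},a_{>k})$. The joint policy is $\pi(a)=\prod_k\pi_k(a_k\mid a_{<k})$; the downstream policy is $\pi_{>k}(\cdot\mid a_{\le k})=\prod_{j>k}\pi_j(\cdot\mid a_{<j})$, and $\pi_{\ge k}\mid a_{<k}$ denotes the law of $(a_k,a_{>k})$ with $a_k\sim\pi_k(\cdot\mid a_{<k})$, $a_{>k}\sim\pi_{>k}(\cdot\mid a_{<k},a_k)$. The team reward $R$ satisfies $|R|\le R_{\max}$ and has conditional mean $f(a)=\mathbb E[R\mid a]$. (An exogenous context is fixed and suppressed.) Here $\pi$ is the current joint policy at the moment agent $k$ is updated, and $\mu$ is the joint policy that collected the batch of rollouts. Additive fit. Encode a joint action as $\psi(a)\in\{0,1\}^d$, $d=KA$, the concatenation of the $K$ per-agent one-hot vectors. From $N$ rollouts under $\mu$ with feature matrix $\Psi\in\mathbb R^{N\times d}$ and reward vector $r\in\mathbb R^N$, let $\hat\varphi=(\lambda I+\Psi^\top\Psi)^{-1}\Psi^\top r=(\hat\varphi_1,\dots,\hat\varphi_K)$, where $\hat\varphi_k$ is viewed as a function on $\mathcal A_k$, and let $\hat f(a)=\sum_{k=1}^K\hat\varphi_k(a_k)$.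 The residual is $\varepsilon(a)=\hat f(a)-f(a)$ and $\|\varepsilon\|_\infty=\max_a|\varepsilon(a)|$. Standing assumption: $\kappa_\mu=\lambda_{\min}(\mathbb E_\mu[\psi(a)\psi(a)^\top])>0$, with the ridge regularizer $\lambda>0$ supplying coverage otherwise. Advantages. $A_k^{\mathrm{SeqAU}}(a_{\le k})=\mathbb E_\pi[R\mid a_{\le k}]-\mathbb E_\pi[R\mid a_{<k}]$ and $\hat A_k^{\mathrm{LS}}(a_{\le k})=\mathbb E_\pi[\hat f(a)\mid a_{\le k}]-\mathbb E_\pi[\hat f(a)\mid a_{<k}]$, where $\hat f$ is treated as fixed and the conditional expectations given $a_{\le k}$ and $a_{<k}$ are over $a_{>k}\sim\pi_{>k}(\cdot\mid a_{\le k})$ and over $\pi_{\ge k}\mid a_{<k}$, respectively. $\|\cdot\|_1$ is the $\ell_1$ norm of the difference of probability mass functions. *)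

(* Defs.v *)
From HB Require Import structures.
From mathcomp Require Import all_boot all_order all_algebra.
From mathcomp Require Import all_classical all_reals all_analysis.

Set Implicit Arguments.
Unset Strict Implicit.
Unset Printing Implicit Defensive.

Import Order.TTheory GRing.Theory Num.Theory.

Local Open Scope classical_set_scope.
Local Open Scope ring_scope.

(* The K agents are the ordinals 0, ..., K-1; T k is the action set of agent k. *)

Definition joint (K : nat) (T : 'I_K -> finType) : finType :=
  {dffun forall k : 'I_K, T k}.

(* a_{<k}: the actions of the agents strictly before k. *)
Definition history (K : nat) (T : 'I_K -> finType) (k : 'I_K) : finType :=
  {dffun forall j : {j : 'I_K | (j < k)%N}, T (val j)}.

(* a_{>k}: the actions of the agents strictly after k. *)
Definition future (K : nat) (T : 'I_K -> finType) (k : 'I_K) : finType :=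
  {dffun forall j : {j : 'I_K | (k < j)%N}, T (val j)}.

Definition history_of (K : nat) (T : 'I_K -> finType) (k : 'I_K)
    (a : joint T) : history T k :=
  [ffun j : {j : 'I_K | (j < k)%N} => a (val j)].

(* The joint action (a_{<k}, a_k, a_{>k}) = (u, x, v). *)
Definition join (K : nat) (T : 'I_K -> finType) (k : 'I_K)
    (u : history T k) (x : T k) (v : future T k) : joint T :=
  [ffun j : 'I_K =>
     match ltngtP j k with
     | CompareNatLt h => u (exist _ j h)
     | CompareNatGt h => v (exist _ j h)
     | CompareNatEq e => ecast i (T i) (val_inj (esym e)) x
     end].

Record policy (R : realType) (K : nat) (T : 'I_K -> finType) := Policy {
  pol :> forall k : 'I_K, history T k -> T k -> R;
  pol_ge0 : forall k u x, 0 <= @pol k u x;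
  pol_sum1 : forall k u, \sum_(x : T k) @pol k u x = 1
}.

Definition joint_prob (R : realType) (K : nat) (T : 'I_K -> finType)
    (pi : policy R T) (a : joint T) : R :=
  \prod_(k : 'I_K) pi k (history_of k a) (a k).

(* pi_{>k}(v | u, x) *)
Definition downstream (R : realType) (K : nat) (T : 'I_K -> finType)
    (pi : policy R T) (k : 'I_K) (u : history T k) (x : T k) (v : future T k)
    : R :=
  let a := join u x v in
  \prod_(j : 'I_K | (k < j)%N) pi j (history_of j a) (a j).

(* Expectation over a_{>k} ~ pi_{>k}(. | u, x). *)
Definition expect_gt (R : realType) (K : nat) (T : 'I_K -> finType)
    (pi : policy R T) (k : 'I_K) (u : history T k) (x : T k)
    (h : future T k -> R) : R :=
  \sum_(v : future T k) downstream pi u x v * h v.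

(* Expectation over (a_k, a_{>k}) ~ pi_{>=k} | u. *)
Definition expect_ge (R : realType) (K : nat) (T : 'I_K -> finType)
    (pi : policy R T) (k : 'I_K) (u : history T k)
    (h : T k -> future T k -> R) : R :=
  \sum_(x : T k) \sum_(v : future T k) pi k u x * downstream pi u x v * h x v.

(* rho a is the law of the team reward given the joint action a. *)
Definition reward_kernel (R : realType) (K : nat) (T : 'I_K -> finType) :=
  joint T -> probability R R.

Definition mean_reward (R : realType) (K : nat) (T : 'I_K -> finType)
    (rho : reward_kernel R T) (a : joint T) : R :=
  fine ('E_(rho a)[id])%E.

(* Laws of the reward given a_{<=k} = (u, x), resp. given a_{<k} = u, when the
   remaining actions follow pi. Conditioning is on the kernels, so it makes
   sense for prefixes of probability zero as well. *)
Definition reward_law_le (R : realType) (K : nat) (T : 'I_K -> finType)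
    (pi : policy R T) (rho : reward_kernel R T) (k : 'I_K)
    (u : history T k) (x : T k) (B : set R) : \bar R :=
  (\sum_(v : future T k) (downstream pi u x v)%:E * rho (join u x v) B)%E.

Definition reward_law_lt (R : realType) (K : nat) (T : 'I_K -> finType)
    (pi : policy R T) (rho : reward_kernel R T) (k : 'I_K)
    (u : history T k) (B : set R) : \bar R :=
  (\sum_(x : T k) \sum_(v : future T k)
     (pi k u x * downstream pi u x v)%:E * rho (join u x v) B)%E.

Definition adv_SeqAU (R : realType) (K : nat) (T : 'I_K -> finType)
    (pi : policy R T) (rho : reward_kernel R T) (k : 'I_K)
    (u : history T k) (x : T k) : R :=
  fine (\int[reward_law_le pi rho u x]_r r%:E)%E
  - fine (\int[reward_law_lt pi rho u]_r r%:E)%E.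

Definition adv_LS (R : realType) (K : nat) (T : 'I_K -> finType)
    (pi : policy R T) (fhat : joint T -> R) (k : 'I_K)
    (u : history T k) (x : T k) : R :=
  expect_gt pi u x (fun v => fhat (join u x v))
  - expect_ge pi u (fun y v => fhat (join u y v)).

(* The features are the pairs (agent, action), listed agent by agent: this is
   the index set of the concatenation of the K per-agent one-hot vectors. *)
Definition feature (K : nat) (T : 'I_K -> finType) : finType :=
  {k : 'I_K & T k}.

Lemma card_feature (K A : nat) (T : 'I_K -> finType) :
  (forall k, #|T k| = A) -> #|feature T| = (K * A)%N.
Proof.
move=> hT; rewrite card_tagged sumnE big_map big_enum /=.
by under eq_bigr do rewrite hT; rewrite sum_nat_const card_ord.
Qed.

Definition psi (R : realType) (K : nat) (T : 'I_K -> finType) (a : joint T)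
    : 'cV[R]_#|feature T| :=
  \col_i let s := enum_val i in (a (tag s) == tagged s)%:R.

(* E_mu [psi psi^T] *)
Definition feature_moment (R : realType) (K : nat) (T : 'I_K -> finType)
    (mu : policy R T) : 'M[R]_#|feature T| :=
  \sum_(a : joint T) joint_prob mu a *: (psi R a *m (psi R a)^T).

(* Smallest real eigenvalue; only used for nonempty symmetric matrices, whose
   spectrum is a nonempty finite set of reals. *)
Definition lambda_min (R : realType) (n : nat) (M : 'M[R]_n) : R :=
  inf [set z : R | eigenvalue M z].

Definition feature_matrix (R : realType) (K : nat) (T : 'I_K -> finType)
    (N : nat) (acts : 'I_N -> joint T) : 'M[R]_(N, #|feature T|) :=
  \matrix_(i < N) (psi R (acts i))^T.

(* In the degenerate case of a singular matrix (possible only for lambda = 0),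
   invmx is the identity function. *)
Definition phi_hat (R : realType) (K : nat) (T : 'I_K -> finType) (N : nat)
    (lambda : R) (acts : 'I_N -> joint T) (rew : 'I_N -> R)
    : 'cV[R]_#|feature T| :=
  let Psi := feature_matrix R acts in
  invmx (lambda%:M + Psi^T *m Psi) *m Psi^T *m \col_i rew i.

Definition f_hat (R : realType) (K : nat) (T : 'I_K -> finType)
    (phi : 'cV[R]_#|feature T|) (a : joint T) : R :=
  \sum_(k : 'I_K) phi (enum_rank (Tagged T (a k) : feature T)) 0.

(* The pairs (acts i, rew i), i < N, are independent, each with law
   mu(a) rho(a, dr). *)
Definition rollouts_under (R : realType) (K : nat) (T : 'I_K -> finType)
    (mu : policy R T) (rho : reward_kernel R T)
    (d : measure_display) (Omega : measurableType d) (P : probability Omega R)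
    (N : nat) (acts : 'I_N -> Omega -> joint T) (rew : 'I_N -> Omega -> R)
    : Prop :=
  [/\ forall i b, measurable [set w | acts i w = b],
      forall i, measurable_fun setT (rew i)
    & forall (b : 'I_N -> joint T) (B : 'I_N -> set R),
        (forall i, measurable (B i)) ->
        P [set w | forall i, acts i w = b i /\ B i (rew i w)]
        = (\prod_(i < N) ((joint_prob mu (b i))%:E * rho (b i) (B i)))%E].

(* All maxima below are over nonempty families of nonnegative reals, so the
   default value 0 plays no role. *)
Definition sup_norm (R : realType) (K : nat) (T : 'I_K -> finType)
    (g : joint T -> R) : R :=
  \big[Num.max/0]_(a : joint T) `|g a|.

(* max over a_k, a_k' of |g(a_{<k}, a_k, a_{>k}) - g(a_{<k}, a_k', a_{>k})| *)
Definition oscillation (R : realType) (K : nat) (T : 'I_K -> finType)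
    (g : joint T -> R) (k : 'I_K) (u : history T k) (v : future T k) : R :=
  \big[Num.max/0]_(x : T k) \big[Num.max/0]_(y : T k)
    `|g (join u x v) - g (join u y v)|.

Definition l1_dist (R : realType) (I : finType) (p q : I -> R) : R :=
  \sum_(i : I) `|p i - q i|.

Definition max_downstream_shift (R : realType) (K : nat) (T : 'I_K -> finType)
    (pi : policy R T) (k : 'I_K) (u : history T k) : R :=
  \big[Num.max/0]_(x : T k) \big[Num.max/0]_(y : T k)
    l1_dist (downstream pi u x) (downstream pi u y).

(* Main.v *)
(** By linearity the bias is the additive-fit advantage of the residual eps,
    i.e. the average over a_k' ~ pi_k of
      E[eps(a_k, .) | a_k] - E[eps(a_k', .) | a_k'],
    the expectations being over a_{>k}.  Each difference splits as
      E[eps(a_k, .) - eps(a_k', .) | a_k']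
      + \sum_{a_{>k}} (pi_{>k}(. | a_k) - pi_{>k}(. | a_k')) eps(a_k, .),
    where the first term is at most the mean oscillation and the second is
    bounded by Hoelder's inequality. *)

Require Import Defs.
From HB Require Import structures.
From mathcomp Require Import all_boot all_order all_algebra.
From mathcomp Require Import all_classical all_reals all_analysis.
From mathcomp Require Import measurable_realfun ring.

Set Implicit Arguments.
Unset Strict Implicit.
Unset Printing Implicit Defensive.

Import Order.TTheory GRing.Theory Num.Theory.
Local Open Scope classical_set_scope.
Local Open Scope ring_scope.

Section Mixture.
Context (d : measure_display) (X : measurableType d) (R : realType).
Context (I : Type) (c : I -> {nonneg R}) (p : I -> {measure set X -> \bar R}).

(** The reward laws are bare set functions. Building the weighted sum from [measure_add] and
    [mscale] gives it a measure structure, and folding over a sequence allows induction on the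
    integral. *)
Definition mixture (s : seq I) : {measure set X -> \bar R} :=
  foldr (fun i (m : {measure set X -> \bar R}) =>
    measure_add (mscale (c i) (p i)) m : {measure set X -> \bar R}) mzero s.

Lemma mixtureE (s : seq I) :
  mixture s = (fun B => \sum_(i <- s) (c i)%:num%:E * p i B)%E
    :> (set X -> \bar R).
Proof.
apply/funext => B; elim: s => [|i s IH]; first by rewrite big_nil.
by rewrite big_cons -IH; exact: measure_addE.
Qed.

Lemma ge0_integral_mixture (s : seq I) (f : X -> \bar R) :
  (forall x, 0 <= f x)%E -> measurable_fun setT f ->
  (\int[mixture s]_x f x = \sum_(i <- s) (c i)%:num%:E * \int[p i]_x f x)%E.
Proof.
move=> f0 mf; elim: s => [|i s IH]; first by rewrite big_nil integral_measure_zero.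
by rewrite big_cons /= ge0_integral_measure_add// ge0_integral_mscale// IH.
Qed.

End Mixture.

(** Linearity in the measure is available for nonnegative integrands, so [f] is split into its
    positive and negative parts. Integrability keeps all the integrals finite, which lets [fine]
    pass through the sums and the difference. *)
Lemma fine_integral_weighted_sum (d : measure_display) (X : measurableType d)
    (R : realType) (I : finType) (c : I -> R)
    (p : I -> {measure set X -> \bar R}) (f : X -> \bar R) :
  measurable_fun setT f -> (forall i, 0 <= c i) ->
  (forall i, (p i).-integrable setT f) ->
  fine (\int[fun B => \sum_i (c i)%:E * p i B]_x f x)%E
  = \sum_i c i * fine (\int[p i]_x f x)%E.
Proof.
move=> mf c0 intf; pose c' i := NngNum (c0 i).
rewrite (_ : (fun _ => _) = mixture c' p (index_enum I)); last first.
  by rewrite mixtureE.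
rewrite integralE !ge0_integral_mixture//; first last.
- exact: measurable_funepos.
- exact: measurable_funeneg.
have fp i : (\int[p i]_x f^\+ x)%E \is a fin_num.
  exact/integrable_fin_num/integrable_funepos.
have fn i : (\int[p i]_x f^\- x)%E \is a fin_num.
  exact/integrable_fin_num/integrable_funeneg.
rewrite fineB; try by apply/sum_fin_numP => i _ _; rewrite fin_numM.
rewrite -!sum_fine; try by move=> i _; rewrite fin_numM.
rewrite -sumrB; apply: eq_bigr => i _.
by rewrite !fineM//= -mulrBr [in RHS]integralE (fineB (fp i) (fn i)).
Qed.

Lemma integrable_ae_bounded (R : realType) (P : probability R R) (M : R) :
  P [set r : R | `|r| <= M] = 1%E -> P.-integrable setT (fun r : R => r%:E).
Proof.
move=> PM; apply/integrableP; split; first exact/measurable_EFinP/measurable_id.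
have mM : measurable [set r : R | `|r| <= M].
  rewrite (_ : mkset _ = setT `&` Num.norm @^-1` `]-oo, M]).
    exact: normr_measurable.
  by rewrite setTI; apply/funext => r; rewrite /= in_itv.
(* Dominating by [|M|] instead of [M] makes the bound nonnegative without a sign hypothesis. *)
apply: (@le_lt_trans _ _ (\int[P]_(r in setT) (cst `|M|%:E r))%E).
  apply: ae_ge0_le_integral => //.
  - apply/measurable_EFinP; exact: normr_measurable.
  - by move=> r _; rewrite lee_fin.
  - exists (~` [set r : R | `|r| <= M]); split.
    + exact: measurableC.
    + by apply: etrans (probability_setC P mM) _; rewrite PM subee.
    + apply: subsetC => r /= rM _; rewrite lee_fin.
      exact: le_trans rM (ler_norm _).
by rewrite integral_cst// [X in (_ * X)%E](probability_setT P) mule1 ltry.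
Qed.

Lemma fine_integral_reward_mixture (R : realType) (K : nat)
    (T : 'I_K -> finType) (rho : reward_kernel R T) (M : R)
    (I : finType) (c : I -> R) (a : I -> joint T) :
  (forall b, rho b [set r : R | `|r| <= M] = 1%E) -> (forall i, 0 <= c i) ->
  fine (\int[fun B => \sum_i (c i)%:E * rho (a i) B]_r r%:E)%E
  = \sum_i c i * mean_reward rho (a i).
Proof.
move=> rhoM c0.
rewrite (@fine_integral_weighted_sum _ _ _ _ c (fun i => rho (a i)))//.
- by apply: eq_bigr => i _; rewrite /mean_reward [in RHS]unlock.
- by move=> i; exact: integrable_ae_bounded (rhoM (a i)).
Qed.

Section Advantage.
Context (R : realType) (K : nat) (T : 'I_K -> finType) (pi : policy R T).
Context (k : 'I_K) (u : history T k).

Lemma downstream_ge0 (x : T k) (v : future T k) : 0 <= downstream pi u x v.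
Proof. by apply: prodr_ge0 => j _; exact: pol_ge0. Qed.

(** This is the tower property: both reward laws are finite mixtures of the laws [rho a], so their
    means are averages of [mean_reward rho]. The two advantages thereby become values of one linear
    functional. *)
Lemma adv_SeqAUE (rho : reward_kernel R T) (M : R) (x : T k) :
  (forall a, rho a [set r : R | `|r| <= M] = 1%E) ->
  adv_SeqAU pi rho u x = adv_LS pi (mean_reward rho) u x.
Proof.
move=> rhoM; congr (_ - _).
  by apply: fine_integral_reward_mixture rhoM _; exact: downstream_ge0.
(* The double sum is reindexed by pairs, so that it is a mixture over a single finite type. *)
rewrite /expect_ge pair_bigA/= (_ : reward_law_lt pi rho u = fun B =>
  \sum_(q : T k * future T k) (pi k u q.1 * downstream pi u q.1 q.2)%:E *
    rho (join u q.1 q.2) B)%E; last first.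
  by apply/funext => B; rewrite /reward_law_lt pair_bigA.
apply: fine_integral_reward_mixture rhoM _ => q.
by rewrite mulr_ge0 ?pol_ge0 ?downstream_ge0.
Qed.

Lemma adv_LSB (f g : joint T -> R) (x : T k) :
  adv_LS pi f u x - adv_LS pi g u x = adv_LS pi (fun a => f a - g a) u x.
Proof.
rewrite /adv_LS opprD addrACA -opprD /expect_gt /expect_ge -!sumrB.
congr (_ - _).
  by apply: eq_bigr => v _; rewrite mulrBr.
apply: eq_bigr => y _; rewrite -sumrB.
by apply: eq_bigr => v _; rewrite mulrBr.
Qed.

Lemma le_sup_norm (g : joint T -> R) (a : joint T) : `|g a| <= sup_norm g.
Proof. exact: (le_bigmax_cond 0 (fun a => `|g a|)). Qed.

Lemma le_oscillation (g : joint T -> R) (x y : T k) (v : future T k) :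
  `|g (join u x v) - g (join u y v)| <= oscillation g u v.
Proof.
apply: le_trans (le_bigmax_cond 0 _ (isT : xpredT x)).
exact: (le_bigmax_cond 0 (fun y => `|g (join u x v) - g (join u y v)|)).
Qed.

Lemma le_max_downstream_shift (x y : T k) :
  l1_dist (downstream pi u x) (downstream pi u y) <= max_downstream_shift pi u.
Proof.
apply: le_trans (le_bigmax_cond 0 _ (isT : xpredT x)).
exact: (le_bigmax_cond 0
  (fun y => l1_dist (downstream pi u x) (downstream pi u y))).
Qed.

(** The cross term pairs the future law of [y] with the values of [g] at [x]. The oscillation is
    thus weighted by the law of [y], as needed for the later average over [y] to yield
    [expect_ge]. *)
Lemma expect_gtB_le (g : joint T -> R) (x y : T k) :
  `|expect_gt pi u x (fun v => g (join u x v))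
    - expect_gt pi u y (fun v => g (join u y v))|
  <= expect_gt pi u y (oscillation g u)
     + sup_norm g * max_downstream_shift pi u.
Proof.
have -> : expect_gt pi u x (fun v => g (join u x v))
    - expect_gt pi u y (fun v => g (join u y v))
  = \sum_v downstream pi u y v * (g (join u x v) - g (join u y v))
    + \sum_v (downstream pi u x v - downstream pi u y v) * g (join u x v).
  by rewrite -sumrB -big_split; apply: eq_bigr => v _ /=; ring.
apply: le_trans (ler_normD _ _) (lerD _ _).
  apply: le_trans (ler_norm_sum _ _ _) (ler_sum _ _) => v _.
  by rewrite normrM ger0_norm ?downstream_ge0// ler_wpM2l ?downstream_ge0
    ?le_oscillation.
(* The default value 0 of the maximum gives this directly. *)
have g0 : 0 <= sup_norm g.
  exact: bigmax_ge_id.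
apply: le_trans (ler_wpM2l g0 (le_max_downstream_shift x y)).
rewrite mulr_sumr; apply: le_trans (ler_norm_sum _ _ _) (ler_sum _ _) => v _.
by rewrite normrM mulrC ler_wpM2r ?le_sup_norm.
Qed.

Lemma expect_geE (h : T k -> future T k -> R) :
  expect_ge pi u h = \sum_y pi k u y * expect_gt pi u y (h y).
Proof.
apply: eq_bigr => y _; rewrite mulr_sumr.
by apply: eq_bigr => v _; rewrite mulrA.
Qed.

Lemma adv_LS_le (g : joint T -> R) (x : T k) :
  `|adv_LS pi g u x|
  <= expect_ge pi u (fun _ v => oscillation g u v)
     + sup_norm g * max_downstream_shift pi u.
Proof.
(* Terms constant in [y] are put under the same average over [y], so that the pairwise bound applies
   summand by summand. *)
have avg (z : R) : z = \sum_y pi k u y * z.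
  by rewrite -mulr_suml pol_sum1 mul1r.
rewrite /adv_LS !expect_geE [expect_gt pi u x _]avg [sup_norm g * _]avg.
rewrite -sumrB -big_split /=.
apply: le_trans (ler_norm_sum _ _ _) (ler_sum _ _) => y _.
rewrite -mulrBr -mulrDr normrM ger0_norm ?pol_ge0//.
by rewrite ler_wpM2l ?pol_ge0// expect_gtB_le.
Qed.

End Advantage.

Theorem theorem3 (R : realType) (K A : nat) (T : 'I_K -> finType)
    (hT : forall k : 'I_K, #|T k| = A)
    (pi mu : policy R T)
    (rho : reward_kernel R T) (Rmax : R)
    (hRmax : forall a : joint T, rho a [set r : R | `|r| <= Rmax] = 1%E)
    (d : measure_display) (Omega : measurableType d) (P : probability Omega R)
    (N : nat) (acts : 'I_N -> Omega -> joint T) (rew : 'I_N -> Omega -> R)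
    (hroll : rollouts_under mu rho P acts rew)
    (lambda : R) (hlambda : 0 <= lambda)
    (hcov : 0 < lambda_min (feature_moment mu) \/ 0 < lambda)
    (w : Omega) (k : 'I_K) (u : history T k) (x : T k)
    (fhat := f_hat (phi_hat lambda (fun i => acts i w) (fun i => rew i w)))
    (eps := fun a : joint T => fhat a - mean_reward rho a) :
  `| adv_LS pi fhat u x - adv_SeqAU pi rho u x |
  <= expect_ge pi u (fun _ v => oscillation eps u v)
     + sup_norm eps * max_downstream_shift pi u.
Proof.
by rewrite (adv_SeqAUE _ _ _ hRmax) adv_LSB; exact: adv_LS_le.
Qed.
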